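(* Let $q\ge5$ be a prime number, let $\lambda\in\Omega$, and consider the algebraic model of $S_\lambda$ given by the normalization of the hyperelliptic curve $$y^2=x\left(x^{2q}+2\,\tfrac{1+\lambda}{1-\lambda}\,x^{q}+1\right).$$ In this model the full automorphism group of $S_\lambda$ is generated by the transformations $$r(x,y)=(\omega_q x,\ \omega_{2q}y)\quad\text{and}\quad s(x,y)=\left(\tfrac1x,\ \tfrac{y}{x^{q+1}}\right),$$ where $\omega_t=\exp(\tfrac{2\pi i}{t})$.
   Context: Let $q\ge 5$ be a prime and let $G=\langle r,s : r^{2q}=s^2=(sr)^2=1\rangle$ be the dihedral group of order $4q$. $\mathcal{F}_q$ denotes the family of compact Riemann surfaces of genus $q$ with exactly $4q$ automorphisms. Every $S\in\mathcal{F}_q$ has full automorphism group $\mathrm{Aut}(S)\cong G$, and the quotient map $S\to S/G\cong\mathbb{P}^1$ has exactly four branch values: three marked with $2$ and one marked with $2q$ (a branch value is marked with the order of the stabilizers of the points above it). The action of $G$ on $S$ is represented by the generating vector $(s,sr^{-2},r^q,r^{q+2})$, i.e. these are the local monodromies of the covering around the branch values with respect to a standard system of loops; up to a Möbius transformation the branch values are $\infty,0,1$ (marked with $2$) and $\lambda$ (marked with $2q$), the entries of the generating vector corresponding to $\infty,0,1,\lambda$ in this order. The set of admissible parameters is $\Omega=\mathbb{C}-\{0,\pm1,\tfrac12,2,\gamma,\gamma^2\}$, where $\gamma\ne -1$ is a fixed complex number with $\gamma^3=-1$. For $\lambda\in\Omega$, $S_\lambda$ denotes the member of $\mathcal{F}_q$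 (unique up to isomorphism) obtained in this way; in particular $S_\lambda$ has exactly $4q$ automorphisms. $S_\lambda$ is isomorphic to the normalization of the hyperelliptic curve displayed in the claim. *)

(* Defs.v *)
From HB Require Import structures.
From mathcomp Require Import all_boot all_order all_algebra.
From mathcomp Require Import complex.
From mathcomp Require Import all_classical all_reals all_analysis.
Set Implicit Arguments.
Unset Strict Implicit.
Unset Printing Implicit Defensive.
Import Order.TTheory GRing.Theory Num.Theory.
Import numFieldNormedType.Exports.
Local Open Scope classical_set_scope.
Local Open Scope ring_scope.

(* The complex numbers, keyed on numClosedFieldType so that they carry the
   topology and the normed module structure given by the modulus. *)
Definition CC (R : realType) : numClosedFieldType := R[i].

(* exp (i a) *)
Definition cis (R : realType) (a : R) : CC R := (cos a +i* sin a)%C.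

Definition omega (R : realType) (t : nat) : CC R := cis (2 * pi / t%:R : R).

Definition real_to_CC (R : realType) (a : R) : CC R := (a +i* 0)%C.

(* A space with an atlas: a set of pairs (U, z), where only the restriction of
   z to U is meaningful. *)
Record surface (R : realType) := Surface {
  points :> topologicalType;
  atlas : set (set points * (points -> CC R)) }.

Section RiemannSurfaces.
Variable R : realType.
Local Notation C := (CC R).
Implicit Types M N : surface R.

Definition is_chart (T : topologicalType) (c : set T * (T -> C)) :=
  [/\ open c.1,
      {in c.1 &, injective c.2} &
      forall U, U `<=` c.1 -> (open U <-> open (c.2 @` U))].

(* The inverse z(U) -> U; the point p is only a value outside z(U). *)
Definition chart_inv (T : topologicalType) (c : set T * (T -> C)) (p : T) :
  C -> T := 'pinv_(fun=> p) c.1 c.2.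

Definition holo_at (T : topologicalType) (c : set T * (T -> C)) (g : T -> C)
  (p : T) : Prop := derivable (g \o chart_inv c p) (c.2 p) 1.

Definition chart_deriv (T : topologicalType) (c : set T * (T -> C))
  (g : T -> C) (p : T) : C := 'D_1 (g \o chart_inv c p) (c.2 p).

(* Second countability is automatic in the compact case, the only one used. *)
Definition compact_riemann_surface M : Prop :=
  [/\ hausdorff_space M, connected [set: M], compact [set: M],
      [set: M] !=set0 &
      [/\ forall p : M, exists2 c, atlas c & c.1 p,
          forall c : set M * (M -> C), atlas c -> is_chart c &
          forall (c d : set M * (M -> C)) (p : M), atlas c -> atlas d ->
            c.1 p -> d.1 p -> holo_at c d.2 p]].

Definition holomorphic M N (F : M -> N) : Prop :=
  continuous F /\
  forall (c : set M * (M -> C)) (d : set N * (N -> C)) (p : M),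
    atlas c -> atlas d -> c.1 p -> d.1 (F p) -> holo_at c (d.2 \o F) p.

Definition biholomorphic M N (F : M -> N) : Prop :=
  holomorphic F /\
  exists G : N -> M, [/\ cancel F G, cancel G F & holomorphic G].

Definition isomorphic M N : Prop := exists F : M -> N, biholomorphic F.

Definition Aut M : set (M -> M) := [set F | biholomorphic F].

(* A holomorphic differential, given by its coefficients w_c in
   "w = w_c dz_c" for each chart c. *)
Definition holomorphic_form M (w : set M * (M -> C) -> M -> C) : Prop :=
  (forall (c : set M * (M -> C)) p, atlas c -> c.1 p -> holo_at c (w c) p) /\
  (forall (c d : set M * (M -> C)) p, atlas c -> atlas d -> c.1 p -> d.1 p ->
    w c p = w d p * chart_deriv c d.2 p).

(* The genus is the dimension of the space of holomorphic differentials. *)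
Definition has_genus M (g : nat) : Prop :=
  exists w : 'I_g -> set M * (M -> C) -> M -> C,
    (forall i, holomorphic_form (w i)) /\
    forall v, holomorphic_form v ->
      exists! a : {ffun 'I_g -> C},
        forall (c : set M * (M -> C)) p, atlas c -> c.1 p ->
          v c p = \sum_(i < g) a i * w i c p.

End RiemannSurfaces.

Inductive generated (T : Type) (A : set (T -> T)) : set (T -> T) :=
| generated_id : generated A id
| generated_mem f : A f -> generated A f
| generated_comp f g : generated A f -> generated A g -> generated A (f \o g)
| generated_inv f g : generated A f -> cancel f g -> cancel g f ->
    generated A g.

(* None is the point at infinity. *)
Definition P1 (R : realType) : surface R :=
  @Surface R (one_point_compactification (CC R))
    [set c | c = (~` [set None], fun z => if z is Some a then a else 0) \/
             c = (~` [set Some 0], fun z => if z is Some a then a^-1 else 0)].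

Section Loops.
Variable R : realType.

Definition unit_itv (t : R) := 0 <= t <= 1.

(* The small positively oriented circle around b, parametrized by [0, 1];
   around infinity, "positively" refers to the coordinate 1/z. *)
Definition circle (b : P1 R) (e : R) (t : R) : P1 R :=
  if b is Some z then Some (z + real_to_CC e * cis (2 * pi * t))
  else Some ((real_to_CC e)^-1 * cis (- (2 * pi * t))).

Definition freely_homotopic (B : set (P1 R)) (l l' : R -> P1 R) : Prop :=
  exists H : R * R -> P1 R, [/\ continuous H,
    forall u t, unit_itv u -> unit_itv t -> ~ B (H (u, t)),
    forall u, unit_itv u -> H (u, 0) = H (u, 1) &
    forall t, unit_itv t -> H (0, t) = l t /\ H (1, t) = l' t].

(* The product (first l 0, then l 1, and so on) of loops based at o is
   homotopic to a constant in the complement of B, relative to o; the i-th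
   loop is run through on [i, i + 1]. *)
Definition product_trivial (n : nat) (B : set (P1 R)) (o : P1 R)
    (l : 'I_n -> R -> P1 R) : Prop :=
  exists H : R * R -> P1 R, [/\ continuous H,
    forall u t, unit_itv u -> 0 <= t <= n%:R -> ~ B (H (u, t)),
    forall u, unit_itv u -> H (u, 0) = o /\ H (u, n%:R) = o,
    forall (i : 'I_n) t, unit_itv t -> H (0, i%:R + t) = l i t &
    forall t, 0 <= t <= n%:R -> H (1, t) = o].

(* A standard system of loops around the points b i: loops based at o, the
   i-th one turning once around b i and around no other b j, whose product in
   the given order is the relation of the fundamental group. *)
Definition standard_system (n : nat) (b : 'I_n -> P1 R) (o : P1 R)
    (l : 'I_n -> R -> P1 R) : Prop :=
  [/\ forall i, [/\ continuous (l i), l i 0 = o, l i 1 = o &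
                    forall t, unit_itv t -> ~ range b (l i t)],
      forall i, exists2 e0 : R, 0 < e0 & forall e, 0 < e < e0 ->
        freely_homotopic (range b) (l i) (circle (b i) e) &
      product_trivial (range b) o l].

(* The automorphisms g i are the local monodromies of the covering p around
   the b i: the i-th loop of a standard system lifts to a path from e to
   g i e, for a base point e independent of i. *)
Definition generating_vector (n : nat) (S : surface R) (p : S -> P1 R)
    (b : 'I_n -> P1 R) (g : 'I_n -> S -> S) : Prop :=
  exists (e : S) (c : 'I_n -> R -> S),
    (forall i, [/\ continuous (c i), c i 0 = e & c i 1 = g i e]) /\
    standard_system b (p e) (fun i => p \o c i).

End Loops.

Section SLambda.
Variable R : realType.
Local Notation C := (CC R).

Definition Omega (gam : C) : set C :=
  [set lam | lam \notin [:: 0; 1; -1; 2^-1; 2; gam; gam ^+ 2]].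

Definition branch_value (lam : C) (i : 'I_4) : P1 R :=
  tnth [tuple None; Some 0; Some 1; Some lam] i.

Definition branch_order (q : nat) (i : 'I_4) : nat :=
  tnth [tuple 2; 2; 2; 2 * q]%N i.

(* (s, s r^-2, r^q, r^(q+2)), for r of order 2 q *)
Definition monodromy_vector (q : nat) (T : Type) (r s : T -> T) (i : 'I_4) :
    T -> T :=
  tnth [tuple s; s \o iter (2 * q - 2) r; iter q r; iter (q + 2) r] i.

Definition stabilizer (S : surface R) (a : S) : set (S -> S) :=
  [set f | Aut f /\ f a = a].

Definition family_F (q : nat) (S : surface R) : Prop :=
  [/\ compact_riemann_surface S, has_genus S q & (@Aut R S #= `I_(4 * q))%card].

(* S is (a representative of the isomorphism class of) S_lambda. As Aut S has
   exactly 4 q elements, the conditions on r and s say that sending the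
   generators of the dihedral group of order 4 q to r and s defines an
   isomorphism onto Aut S. *)
Definition is_S_lambda (q : nat) (lam : C) (S : surface R) : Prop :=
  family_F q S /\
  exists (r s : S -> S) (p : S -> P1 R),
    [/\ [/\ @Aut R S = generated [set r; s],
            iter (2 * q) r = id, s \o s = id & (s \o r) \o (s \o r) = id],
        holomorphic p /\ range p = setT,
        forall a b, p a = p b <-> exists2 f, @Aut R S f & f a = b,
        (forall i a, p a = branch_value lam i ->
           (stabilizer a #= `I_(branch_order q i))%card) /\
        (forall a, ~ range (branch_value lam) (p a) ->
           stabilizer a = [set id]) &
        generating_vector p (branch_value lam) (monodromy_vector q r s)].

End SLambda.

Section Hyperelliptic.
Variable R : realType.
Local Notation C := (CC R).
Variables (f : {poly C}) (g : nat).

Definition affine_curve : set (C * C) := [set P | P.2 ^+ 2 = f.[P.1]].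

(* For f squarefree of degree 2 g + 1 the affine curve y^2 = f(x) is smooth,
   and the normalization of its projective closure has exactly one more point,
   None, at which x has a pole. In the coordinates u = 1/x, v = y/x^(g+1) it
   is the origin of v^2 = h(u), where h(u) = u^(2g+2) f(1/u). *)
Definition hyp_space := one_point_compactification affine_curve.

Definition poly_at_infinity : {poly C} :=
  \poly_(i < (2 * g + 3)%N) f`_(2 * g + 2 - i).

Definition xcoord (P : hyp_space) : C := if P is Some p then (set_val p).1 else 0.
Definition ycoord (P : hyp_space) : C := if P is Some p then (set_val p).2 else 0.
Definition vcoord (P : hyp_space) : C := ycoord P / xcoord P ^+ g.+1.

(* The charts are those of the implicit function theorem: x where y != 0 and
   y where f'(x) != 0 on the curve y^2 = f(x), and v where h'(u) != 0 on the
   curve v^2 = h(u), on open sets small enough for them to be homeomorphisms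
   onto their images. *)
Definition hyp_atlas : set (set hyp_space * (hyp_space -> C)) :=
  [set c | is_chart c /\
    [\/ c.2 = xcoord /\
          (forall P, c.1 P -> P <> None /\ ycoord P != 0),
        c.2 = ycoord /\
          (forall P, c.1 P -> P <> None /\ f^`().[xcoord P] != 0) |
        c.2 = vcoord /\
          (forall P, c.1 P -> P <> None -> xcoord P != 0 /\
             poly_at_infinity^`().[(xcoord P)^-1] != 0)]].

Definition hyp_surface : surface R := @Surface R hyp_space hyp_atlas.

End Hyperelliptic.

(* For q >= 1 and lam different from 0 and 1 this polynomial is squarefree of
   degree 2 q + 1. *)
Definition model_poly (R : realType) (q : nat) (lam : CC R) : {poly CC R} :=
  'X * ('X^(2 * q) + (2 * ((1 + lam) / (1 - lam))) *: 'X^q + 1).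

Definition model (R : realType) (q : nat) (lam : CC R) : surface R :=
  hyp_surface (model_poly q lam) q.

(* Main.v *)
(* Since S_lambda is isomorphic to the model and has exactly 4q automorphisms,
   so has the model; it therefore suffices that r and s are automorphisms of the
   model generating at least 4q different maps, the r^i and the s r^i.

   To transport Aut S the model must have charts everywhere. At points with
   y != 0 this is the existence of square roots, and at points with f'(x) != 0
   it is the existence of roots of f - y^2 close to x together with the local
   injectivity of f; these two cases cover the affine curve because
   lambda != 0 makes f squarefree. Since f is palindromic, s exchanges the
   charts y and v, and thereby the origin and the point at infinity; the
   neighbourhoods of the latter are described by |x| > M, by compactness of
   closed bounded parts of the curve. Holomorphy of the transition maps of the
   model is inherited from S, and r and s act on the coordinates x, y, v by
   scalars and by (x, y, v) |-> (1/x, v, y) respectively. *)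

Require Import Defs.
From HB Require Import structures.
From mathcomp Require Import all_boot all_order all_algebra.
From mathcomp Require Import complex.
From mathcomp Require Import all_classical all_reals all_analysis.
From mathcomp Require Import zify ring lra.
Import Order.TTheory GRing.Theory Num.Theory.
Import numFieldNormedType.Exports.
Local Open Scope classical_set_scope.
Local Open Scope ring_scope.

Set Implicit Arguments.
Unset Strict Implicit.
Unset Printing Implicit Defensive.

(** * Holomorphy in a chart: locality and the chain rule *)

Section Charts.
Variable R : realType.
Local Notation C := (CC R).
Implicit Types T : topologicalType.

Lemma chart_invK T (c : set T * (T -> C)) p x :
  is_chart c -> c.1 x -> chart_inv c p (c.2 x) = x.
Proof. by case=> _ inj _ cx; rewrite /chart_inv pinvKV// inE. Qed.

(** The forward half of the openness condition in [is_chart] makes the inverse continuous: a small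
    open neighbourhood of [p] has an open image, and [chart_inv] maps this image back. *)
Lemma chart_inv_cvg T (c : set T * (T -> C)) p :
  is_chart c -> c.1 p -> chart_inv c p x @[x --> c.2 p] --> p.
Proof.
move=> cc cp W Wp.
have [oc inj homeo] := cc.
have : nbhs p (W `&` c.1) by apply: filterI => //; exact: open_nbhs_nbhs.
rewrite nbhsE => -[V [oV Vp] VW].
have oVi : open (c.2 @` V).
  by apply/(homeo V) => // x /VW[].
apply: (@filterS _ (nbhs (c.2 p)) _ (c.2 @` V)).
  by move=> _ [x Vx <-] /=; rewrite chart_invK//; have [] := VW _ Vx.
by apply: open_nbhs_nbhs; split => //; exists p.
Qed.

Lemma holo_at_near T (c : set T * (T -> C)) (g h : T -> C) p :
  is_chart c -> c.1 p -> (\forall x \near p, g x = h x) ->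
  holo_at c g p -> holo_at c h p.
Proof.
move=> cc cp gh; rewrite /holo_at; apply: near_eq_derivable.
exact: (chart_inv_cvg cc cp gh).
Qed.

Lemma holo_at_post T (c : set T * (T -> C)) (g : T -> C) (k : C -> C) p :
  is_chart c -> c.1 p ->
  derivable k (g p) 1 -> holo_at c g p -> holo_at c (k \o g) p.
Proof.
move=> cc cp /derivable1_diffP dk /derivable1_diffP dg.
have e := chart_invK p cc cp.
apply/derivable1_diffP.
apply: (@differentiable_comp C C C C (g \o chart_inv c p) k); first exact: dg.
by rewrite /comp e; exact: dk.
Qed.

(** Near [p] one has g o F = (g o d^-1) o (d o F), and the chain rule applies. Continuity of [F]
    keeps [F x] in the domain of [d]. *)
Lemma holo_at_comp T T' (c : set T * (T -> C)) (d : set T' * (T' -> C))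
    (F : T -> T') (g : T' -> C) p :
  is_chart c -> is_chart d -> c.1 p -> d.1 (F p) ->
  F x @[x --> p] --> F p ->
  holo_at c (d.2 \o F) p -> holo_at d g (F p) -> holo_at c (g \o F) p.
Proof.
move=> cc cd cp dFp cF hF hg.
refine (@holo_at_near _ c ((g \o chart_inv d (F p)) \o (d.2 \o F)) _ p
  cc cp _ _).
  have : \forall x \near p, d.1 (F x).
    by apply: cF; apply: open_nbhs_nbhs; split => //; case: cd.
  by apply: filterS => x dx /=; rewrite chart_invK.
exact: (holo_at_post cc cp hg hF).
Qed.

End Charts.

(** * Composition and transport of biholomorphic maps *)

Section Surfaces.
Variable R : realType.
Local Notation C := (CC R).
Implicit Types M N K : surface R.

(** The clauses on charts in [compact_riemann_surface] apart from holomorphy of the transition maps,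
    which for the model becomes available only through its isomorphism with S. *)
Definition charted M :=
  (forall p : M, exists2 c, @atlas R M c & c.1 p) /\
  (forall c : set M * (M -> C), atlas c -> is_chart c).

Lemma holomorphic_comp M N K (F : M -> N) (G : N -> K) :
  charted M -> charted N -> holomorphic F -> holomorphic G ->
  holomorphic (G \o F).
Proof.
move=> [_ cM] [eN cN] [cF hF] [cG hG]; split.
  by move=> x; apply: continuous_comp; [exact: cF|exact: cG].
move=> c d p ac ad cp dp.
have [m am mp] := eN (F p).
have -> : d.2 \o (G \o F) = (d.2 \o G) \o F by [].
exact: (holo_at_comp (cM _ ac) (cN _ am) cp mp (cF p) (hF _ _ _ ac am cp mp)
  (hG _ _ _ am ad mp dp)).
Qed.

Lemma biholomorphic_comp M N K (F : M -> N) (G : N -> K) :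
  charted M -> charted N -> charted K ->
  biholomorphic F -> biholomorphic G -> biholomorphic (G \o F).
Proof.
move=> cM cN cK [hF [F' [FK KF hF']]] [hG [G' [GK KG hG']]].
split; first exact: holomorphic_comp.
exists (F' \o G'); split; last exact: holomorphic_comp.
  exact: can_comp.
exact: can_comp.
Qed.

Lemma biholomorphic_inv M N (F : M -> N) (G : N -> M) :
  biholomorphic F -> cancel F G -> cancel G F -> biholomorphic G.
Proof.
move=> [hF [F' [FK KF hF']]] FG GF.
have -> : G = F' by apply/funext => x; rewrite -{1}[x]KF FG.
by split => //; exists F.
Qed.

(* The transition maps d o c^-1 of N are holomorphic because they factor through
   charts of M. *)
Lemma isomorphic_id M N :
  charted M -> charted N -> isomorphic M N -> holomorphic (@id N).
Proof.
move=> cM cN [F [hF [G [FG GF hG]]]].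
have -> : id = F \o G by apply/funext => x; rewrite /= GF.
exact: holomorphic_comp hF.
Qed.

(** Holomorphy of the identity is the compatibility of the charts, hence a hypothesis here. *)
Lemma biholomorphic_id M : holomorphic (@id M) -> biholomorphic (@id M).
Proof. by move=> h; split => //; exists id; split. Qed.

(** Conjugation by the isomorphism is a bijection between the automorphism groups. *)
Lemma isomorphic_Aut M N (A : set nat) :
  charted M -> charted N -> isomorphic M N -> (@Aut R M #= A)%card ->
  (@Aut R N #= A)%card.
Proof.
move=> cM cN [F bF]; have [hF [G [FG GF hG]]] := bF.
have bG : biholomorphic G by exact: biholomorphic_inv bF FG GF.
apply: card_eq_trans.
have -> : @Aut R N = (fun h => F \o h \o G) @` @Aut R M.
  apply/seteqP; split => [h hh|_ [h hh <-]].
    exists (G \o h \o F).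
      apply: biholomorphic_comp => //; exact: biholomorphic_comp.
    by apply/funext => x /=; rewrite !GF.
  apply: biholomorphic_comp => //; exact: biholomorphic_comp.
apply: inj_card_eq => h k _ _ e.
apply/funext => x; have := congr1 (fun u => G (u (F x))) e.
by rewrite /= !FG.
Qed.

Lemma generated_sub_Aut M (A : set (M -> M)) :
  charted M -> holomorphic (@id M) -> A `<=` @Aut R M ->
  generated A `<=` @Aut R M.
Proof.
move=> cM hid AM f; elim => {f} [|f /AM//|f g _ hf _ hg|f g _ hf fg gf].
- exact: biholomorphic_id.
- exact: biholomorphic_comp.
- exact: biholomorphic_inv fg gf.
Qed.

End Surfaces.

(** * Polynomial maps: continuity, openness, local injectivity *)

Section Polynomials.

Lemma horner_cvg (K : numFieldType) (p : {poly K}) T (F : set_system T)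
    {FF : Filter F} (g : T -> K) (x : K) :
  g t @[t --> F] --> x -> p.[g t] @[t --> F] --> p.[x].
Proof.
move=> gx; elim/poly_ind: p => [|p c IH].
  rewrite (_ : (fun t => 0.[g t]) = cst 0) ?horner0; first exact: cvg_cst.
  by apply/funext => z; rewrite horner0.
rewrite (_ : (fun t => (p * 'X + c%:P).[g t]) = fun t => p.[g t] * g t + c).
  by rewrite hornerMXaddC; apply: cvgD; [exact: cvgM|exact: cvg_cst].
by apply/funext => z; rewrite hornerMXaddC.
Qed.

Lemma exprn_cvg (K : numFieldType) T (F : set_system T) {FF : Filter F}
    (g : T -> K) (x : K) n :
  g t @[t --> F] --> x -> g t ^+ n @[t --> F] --> x ^+ n.
Proof.
move=> gx; have := @horner_cvg K 'X^n T F FF g x gx.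
rewrite hornerXn (_ : (fun t => 'X^n.[g t]) = fun t => g t ^+ n)//.
by apply/funext => t; rewrite hornerXn.
Qed.

Lemma horner_close (K : numFieldType) (p : {poly K}) (x e : K) : 0 < e ->
  exists2 d, 0 < d & forall z, `|z - x| < d -> `|p.[z] - p.[x]| < e.
Proof.
move=> e0; have /cvgrPdist_lt/(_ e e0) : p.[z] @[z --> x] --> p.[x].
  exact: (@horner_cvg K p K (nbhs x) _ id x cvg_id).
move=> /nbhs_normP[d d0 h]; exists d => // z zx.
by rewrite distrC; apply: h; rewrite /ball_ /= distrC.
Qed.

(* p - w is a product of linear factors over its roots, so at least one root is
   within (|p(x) - w| / |lead_coef p|)^(1/deg p) of x. *)
Lemma horner_open (K : numClosedFieldType) (p : {poly K}) (x e : K) :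
  (1 < size p)%N -> 0 < e ->
  exists2 d, 0 < d & forall w, `|w - p.[x]| < d ->
    exists2 z, `|z - x| < e & p.[z] = w.
Proof.
move=> sp e0; have p0 : p != 0 by rewrite -size_poly_gt0 (ltn_trans _ sp).
exists (`|lead_coef p| * e ^+ (size p).-1).
  by rewrite mulr_gt0 ?exprn_gt0// normr_gt0 lead_coef_eq0.
move=> w; set q := p - w%:P.
have sq : size q = size p.
  by rewrite size_polyDl// size_polyN (leq_ltn_trans (size_polyC_leq1 _)).
have lq : lead_coef q = lead_coef p.
  by rewrite lead_coefDl// size_polyN (leq_ltn_trans (size_polyC_leq1 _)).
have [r qr] := closed_field_poly_normal q.
have sr : size r = (size p).-1.
  rewrite -sq qr size_scale ?size_prod_XsubC//.
  by rewrite lq lead_coef_eq0.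
have [/hasP[z zr zx] _|/hasPn far] := boolP (has (fun z => `|z - x| < e) r).
  exists z => //; apply/eqP; rewrite -subr_eq0.
  have -> : p.[z] - w = q.[z] by rewrite !hornerE.
  by rewrite qr hornerZ horner_prod (big_rem z)//= hornerXsubC subrr mul0r mulr0.
rewrite -normrN opprB.
have -> : p.[x] - w = q.[x] by rewrite !hornerE.
rewrite qr hornerZ horner_prod normrM lq normr_prod -sr => /lt_geF /negP[].
rewrite ler_wpM2l//.
have -> : e ^+ size r = \prod_(z <- r) e.
  by rewrite big_const_seq count_predT iter_mulr_1.
rewrite big_seq [leRHS]big_seq; apply: ler_prod => z /far.
rewrite !hornerE distrC -real_leNgt ?normr_real ?gtr0_real// => ->.
by rewrite ltW.
Qed.

(** [G] is the divided difference of [p], extended to the diagonal by the derivative. It is built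
    along Horner's recursion, which yields its continuity. *)
Lemma horner_quotient (K : numFieldType) (p : {poly K}) :
  exists G : K * K -> K,
  [/\ forall u v, p.[u] - p.[v] = (u - v) * G (u, v),
      forall u, G (u, u) = p^`().[u] & continuous G].
Proof.
elim/poly_ind: p => [|p c [G [h1 h2 h3]]].
  exists (fun=> 0); split => [u v|u|x]; last exact: cvg_cst.
    by rewrite !horner0 subrr mulr0.
  by rewrite deriv0 horner0.
exists (fun z => G z * z.1 + p.[z.2]); split => [u v|u|z].
- rewrite !hornerMXaddC /=.
  have -> : p.[u] = p.[v] + (u - v) * G (u, v) by rewrite -h1 addrC subrK.
  ring.
- by rewrite derivD derivC addr0 derivM derivX mulr1 hornerD hornerMX h2.
- apply: cvgD; last first.
    by apply: (@horner_cvg K p _ (nbhs z) _ snd z.2); exact: cvg_snd.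
  by apply: cvgM; [exact: h3|exact: cvg_fst].
Qed.

(** The divided difference is continuous and equals p'(x) at (x, x), so it is nonzero nearby; there
    p(u) - p(v) = (u - v) G(u, v) vanishes only for u = v. *)
Lemma horner_locally_inj (K : numFieldType) (p : {poly K}) (x : K) :
  p^`().[x] != 0 ->
  exists2 e, 0 < e & forall u v, `|u - x| < e -> `|v - x| < e ->
    p.[u] = p.[v] -> u = v.
Proof.
move=> p'x; have [G [h1 h2 h3]] := horner_quotient p.
have [] := (cvgrPdist_lt _ _).1 (h3 (x, x)) `|p^`().[x]|.
  by rewrite normr_gt0.
move=> [A B] /= [xA xB] AB.
have /nbhs_normP[e e0 eAB] : nbhs x (A `&` B) by exact: filterI.
exists e => // u v ux vx puv; apply/eqP; rewrite -subr_eq0.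
have /eqP := h1 u v; rewrite puv subrr eq_sym mulf_eq0 => /orP[//|/eqP G0].
have /AB/= : (A `*` B) (u, v).
  have [Au _] : (A `&` B) u by apply: eAB; rewrite /ball_ /= distrC.
  by have [_ Bv] : (A `&` B) v by apply: eAB; rewrite /ball_ /= distrC.
by rewrite G0 subr0 h2 ltxx.
Qed.

End Polynomials.

(** * Compactness of closed discs in the complex plane *)

Section ComplexDisc.
Variable R : realType.
Local Notation C := (CC R).

Lemma real_to_CC_cvg (x : R) :
  (real_to_CC y : C) @[y --> x] --> (real_to_CC x : C).
Proof.
apply/cvgrPdist_lt => e e0.
(* In the partial order of C, [0 < e] makes [e] real, so it can be compared with real distances. *)
have eR : (complex.Re e)%:C%C = e :> C by apply: RRe_real; exact: gtr0_real.
have e'0 : 0 < complex.Re e by rewrite -ltcR eR.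
apply: (@filterS _ (nbhs x) _ (ball x (complex.Re e))); last exact: nbhsx_ballx.
move=> y; rewrite /ball /= => xy.
have -> : real_to_CC x - real_to_CC y = (x - y)%:C%C :> C.
  by rewrite /real_to_CC rmorphB.
rewrite normc_def /= expr0n addr0 sqrtr_sqr -eR.
by rewrite ltcR.
Qed.

Lemma rectangle_continuous :
  continuous
    (fun z : R * R => real_to_CC z.1 + (0 +i* 1)%C * real_to_CC z.2 : C).
Proof.
move=> z; apply: cvgD.
  apply: (@cvg_comp _ _ _ fst (@real_to_CC R) _ (nbhs z.1));
    first exact: cvg_fst.
  exact: real_to_CC_cvg.
apply: cvgM; first exact: cvg_cst.
apply: (@cvg_comp _ _ _ snd (@real_to_CC R) _ (nbhs z.2));
    first exact: cvg_snd.
exact: real_to_CC_cvg.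
Qed.

Lemma closed_disc (M : C) : closed [set z : C | `|z| <= M].
Proof.
rewrite -[X in closed X]setCK; apply: open_closedC; rewrite openE => z /= zM.
(* If [M] is not real, no modulus is below it: the disc is empty and any radius, here 1, works. *)
have [Mr|/negP nMr] := boolP (M \is Num.real); last first.
  apply/nbhs_normP; exists (1 : C); first exact: ltr01.
  move=> y _ /= yM; apply: nMr.
  exact: ger0_real (le_trans _ yM).
have {}zM : M < `|z| by rewrite real_ltNge ?normr_real//; exact/negP.
apply/nbhs_normP; exists (`|z| - M); first by rewrite /= subr_gt0.
move=> y; rewrite /ball_ /= => zy yM.
have /lt_geF/negP := lt_le_trans zy (lerB (lexx `|z|) yM); apply.
exact: lerB_dist.
Qed.

(** The disc is a closed subset of the continuous image of a compact square in R^2. *)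
Lemma compact_disc (M : C) : compact [set z : C | `|z| <= M].
Proof.
pose m := complex.Re M.
have cm : compact (`[- m, m] : set R) by exact: segment_compact.
have cR := continuous_compact
  (continuous_subspaceT (A := `[- m, m] `*` `[- m, m]) rectangle_continuous)
  (compact_setX cm cm).
refine (subclosed_compact (@closed_disc M) cR _).
move=> z /= zM.
have MR : m%:C%C = M :> C.
  by apply: RRe_real; exact: ger0_real (le_trans _ zM).
have sq : complex.Re z ^+ 2 + complex.Im z ^+ 2 <= m ^+ 2.
  rewrite -lecR; rewrite add_Re2_Im2 rmorphXn /= MR.
  by rewrite lerXn2r ?nnegrE//; exact: le_trans (normr_ge0 _) zM.
have m0 : 0 <= m by rewrite -lecR MR; exact: le_trans (normr_ge0 _) zM.
have bound (a : R) : a ^+ 2 <= m ^+ 2 -> a \in `[- m, m].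
  move=> am; rewrite in_itv /= -ler_norml -(ler_pXn2r (n := 2)) ?nnegrE//.
  by rewrite real_normK ?num_real.
exists (complex.Re z, complex.Im z).
  split; apply: bound; apply: le_trans sq; first by rewrite lerDl sqr_ge0.
  by rewrite lerDr sqr_ge0.
by case: (z) => a b; rewrite /real_to_CC; simpc.
Qed.

End ComplexDisc.

(** * Neighbourhoods and compact sets on the compactified curve *)

Section HyperellipticTopology.
Variable R : realType.
Local Notation C := (CC R).
Variable f : {poly C}.
Local Notation X := (hyp_space f).
Implicit Types (P Q : affine_curve f) (W : set X).

Lemma curveP P : (set_val P).2 ^+ 2 = f.[(set_val P).1].
Proof. by have := set_valP P. Qed.

Lemma set_val_cvg P : set_val Q @[Q --> P] --> (set_val P : C * C).
Proof.
exact: (@initial_continuous (affine_curve f) (C * C)%type set_val P).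
Qed.

Lemma nbhs_set_val P (W : set (affine_curve f)) (A : set (C * C)) :
  (fun Q => A (set_val Q)) `<=` W -> nbhs (set_val P : C * C) A -> nbhs P W.
Proof. by move=> AW /set_val_cvg; exact: filterS AW. Qed.

Lemma ball_nbhs_affine P (W : set (affine_curve f)) (e : C) : 0 < e ->
  (forall Q, `|(set_val Q).1 - (set_val P).1| < e ->
    `|(set_val Q).2 - (set_val P).2| < e -> W Q) -> nbhs P W.
Proof.
move=> e0 eW.
pose O : set (C * C) := ball (set_val P).1 e `*` ball (set_val P).2 e.
have nO : nbhs (set_val P : C * C) O.
  by exists (ball (set_val P).1 e, ball (set_val P).2 e) => //; split;
    exact: nbhsx_ballx.
apply: nbhs_set_val nO => Q [Q1 Q2].
by refine (eW Q _ _); rewrite distrC; [exact: Q1|exact: Q2].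
Qed.

Lemma nbhs_affine_ball P (W : set (affine_curve f)) : nbhs P W ->
  exists2 e : C, 0 < e & forall Q, `|(set_val Q).1 - (set_val P).1| < e ->
    `|(set_val Q).2 - (set_val P).2| < e -> W Q.
Proof.
rewrite (@nbhsE _ P) => -[_ [[Z oZ <-] PZ] ZW].
have [[A B] /= [nA nB] AB] : nbhs (set_val P : C * C) Z.
  exact: open_nbhs_nbhs.
have /nbhs_normP[d d0 dA] := nA; have /nbhs_normP[e e0 eB] := nB.
have [k k0 [kd ke]] : exists2 k, 0 < k & k <= d /\ k <= e.
  have [de|] := boolP (d <= e); first by exists d.
  by rewrite -real_ltNge ?gtr0_real// => /ltW ed; exists e.
exists k => // Q Q1 Q2; apply: ZW; apply: AB; split => /=.
  by apply: dA; rewrite /ball_ /= distrC (lt_le_trans Q1).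
by apply: eB; rewrite /ball_ /= distrC (lt_le_trans Q2).
Qed.

Lemma nbhs_affineP P (W : set (affine_curve f)) : nbhs P W <->
  exists2 e : C, 0 < e & forall Q, `|(set_val Q).1 - (set_val P).1| < e ->
    `|(set_val Q).2 - (set_val P).2| < e -> W Q.
Proof.
split; first exact: nbhs_affine_ball.
by move=> [e e0 eW]; exact: (ball_nbhs_affine e0).
Qed.

Lemma curve_closed : closed (affine_curve f).
Proof.
have -> : affine_curve f = (fun z : C * C => z.2 ^+ 2 - f.[z.1]) @^-1` [set 0].
  apply/seteqP; split => z /=.
    by rewrite /affine_curve /= => ->; rewrite subrr.
  by move/eqP; rewrite subr_eq0 => /eqP.
apply: preimage_closed; last first.
  exact: (accessible_closed_set1 (hausdorff_accessible (@norm_hausdorff C C))).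
move=> z _; apply: cvgB.
  by apply: cvgM; exact: cvg_snd.
by apply: (@horner_cvg C f _ (nbhs z) _ fst z.1); exact: cvg_fst.
Qed.

(** The curve is closed, so [K] meets it in a compact set. A cluster point of the image filter in
    C^2 thus lies on the curve and, by the subspace topology, is one of the original filter. *)
Lemma affine_compact (K : set (C * C)) :
  compact K -> compact [set P : affine_curve f | K (set_val P)].
Proof.
move=> cK F FF FK.
have [|z [[Kz fz] cz]] := compact_closedI cK curve_closed
    (fmap_proper_filter set_val FF).
  by refine (@filterS _ F _ _ _ _ FK) => P KP; split => //; exact: curveP.
exists (exist _ z (mem_set fz)); split => // U V FU.
rewrite (@nbhsE (affine_curve f)) => -[_ [[Z oZ <-] PZ] ZV].
have [|_ [[Q UQ <-] ZQ]] := cz (set_val @` U) Z _ (open_nbhs_nbhs (conj oZ PZ)).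
  by refine (@filterS _ F _ _ _ _ FU) => Q UQ; exists Q.
by exists Q; split => //; exact: ZV.
Qed.

Lemma bounded_compact (M : C) :
  compact [set P : affine_curve f | `|(set_val P).1| <= M].
Proof.
(* The triangle inequality bounds |f(x)| by [N] on the disc; taking [|M|] keeps [N] nonnegative
   whatever [M] is. *)
pose N := \sum_(i < size f) `|f`_i| * `|M| ^+ i.
have N0 : 0 <= N.
  by apply: sumr_ge0 => i _; rewrite mulr_ge0 ?exprn_ge0.
have := affine_compact
  (compact_setX (@compact_disc R M) (@compact_disc R (N + 1))).
congr compact; apply/seteqP; split => [P []//|P /= PM]; split => //=.
have {}PM : `|(set_val P).1| <= `|M|.
  by rewrite (ger0_norm (le_trans _ PM)).
have : `|(set_val P).2| ^+ 2 <= N.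
  rewrite -normrX curveP horner_coef; apply: le_trans (ler_norm_sum _ _ _) _.
  apply: ler_sum => i _; rewrite normrM normrX ler_wpM2l//.
  by rewrite lerXn2r ?nnegrE.
move: `|(set_val P).2| (normr_ge0 (set_val P).2) => y y0 yN.
rewrite real_leNgt ?(ger0_real y0) ?(ger0_real (addr_ge0 N0 (@ler01 C)))//.
(* From |y| > N + 1 it would follow that |y| > 1 and |y| <= |y|^2 <= N. *)
apply/negP => Ny.
have y1 : 1 < y by apply: le_lt_trans Ny; rewrite lerDr.
have : y <= y ^+ 2 by rewrite expr2 ler_peMl// ltW.
by move=> /le_trans/(_ yN)/(lt_le_trans Ny)/lt_geF; rewrite lerDl ler01.
Qed.

Lemma affine_x_cvg P :
  (set_val Q).1 @[Q --> P] --> ((set_val P).1 : C).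
Proof.
refine ((@cvgrPdist_lt _ _ _ _ (nbhs_filter P) _ _).2 _) => e e0.
by apply/nbhs_affineP; exists e => // Q Q1 _; rewrite distrC.
Qed.

Lemma bounded_closed (M : C) :
  closed [set P : affine_curve f | `|(set_val P).1| <= M].
Proof.
apply: (@preimage_closed (affine_curve f) C (fun P => (set_val P).1)
  [set z | `|z| <= M]); last exact: closed_disc.
move=> P _; exact: affine_x_cvg.
Qed.

(** Close to each point P of [K] the bound |x(P)| + 1 holds; the near-covering form of compactness
    merges these local bounds into one. *)
Lemma compact_bounded_x (K : set (affine_curve f)) : compact K ->
  exists2 M : C, 0 < M & forall P, K P -> `|(set_val P).1| <= M.
Proof.
move=> /compact_near_coveringP/(_ C (pinfty_nbhs C)
  (fun M P => `|(set_val P).1| < M) _)[].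
  move=> P KP.
  exists ([set Q : affine_curve f | `|(set_val Q).1 - (set_val P).1| < 1],
      [set M | `|(set_val P).1| + 1 < M]).
    split => /=; first by apply/nbhs_affineP; exists 1.
    by exists (`|(set_val P).1| + 1); split => //; rewrite realD ?normr_real.
  move=> [Q M] /= [QP]; apply: le_lt_trans.
  rewrite -[X in `|X| <= _](subrK (set_val P).1) addrC.
  by rewrite (le_trans (ler_normD _ _))// lerD2l ltW.
move=> M [Mr MK]; exists (`|M| + 1); first by rewrite ltr_wpDl.
move=> P KP; apply/ltW/(MK (`|M| + 1)) => //.
by rewrite ltr_pwDr// real_ler_norm.
Qed.

Lemma nbhs_SomeP P W : nbhs (Some P : X) W <->
  exists2 e : C, 0 < e & forall Q, `|(set_val Q).1 - (set_val P).1| < e ->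
    `|(set_val Q).2 - (set_val P).2| < e -> W (Some Q).
Proof. exact: nbhs_affineP. Qed.

(** Each set |x| <= M is closed and compact, and every compact set lies in one of them, so their
    complements form a neighbourhood basis at infinity. *)
Lemma nbhs_NoneP W : nbhs (None : X) W <->
  W None /\ exists2 M : C, 0 < M & forall Q, M < `|(set_val Q).1| -> W (Some Q).
Proof.
split.
  move=> [K [/compact_bounded_x[M M0 KM] cK] KW].
  split; first by apply: KW; right.
  exists M => // Q MQ; apply: KW; left; exists Q => // /KM.
  by rewrite lt_geF.
move=> [W0 [M M0 MW]].
exists [set P : affine_curve f | `|(set_val P).1| <= M].
  by split; [exact: bounded_compact|exact: bounded_closed].
move=> _ [[P /= PM <-]|-> //]; apply: MW.
by rewrite real_ltNge ?normr_real ?gtr0_real//; exact/negP.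
Qed.

End HyperellipticTopology.

(** * Charts given by the coordinates x and y *)

Section ChartConstruction.
Variable R : realType.
Local Notation C := (CC R).

(** Openness and continuity at each point give the two directions of the condition in [is_chart].
    For the second, injectivity identifies [U] with the points of [c.1] whose value lies in the
    image of [U]. *)
Lemma is_chart_local (T : topologicalType) (c : set T * (T -> C)) :
  open c.1 -> {in c.1 &, injective c.2} ->
  (forall p, c.1 p -> c.2 x @[x --> p] --> c.2 p) ->
  (forall p W, c.1 p -> nbhs p W -> nbhs (c.2 p) (c.2 @` W)) ->
  is_chart c.
Proof.
move=> oc inj cont op; split => // U Uc; split.
  move=> oU; rewrite openE => _ [p Up <-] /=; apply: op; first exact: Uc.
  exact: open_nbhs_nbhs.
move=> oU; rewrite openE => p Up /=.
have cp := Uc _ Up.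
have h1 : nbhs p (c.2 @^-1` (c.2 @` U)).
  by apply: (cont p cp); apply: open_nbhs_nbhs; split => //; exists p.
have h2 : nbhs p c.1 by exact: open_nbhs_nbhs.
apply: filterS (filterI h1 h2) => x [[y Uy yx] cx].
by rewrite -(inj y x)// inE//; exact: Uc.
Qed.

Variables (f : {poly C}) (g : nat).
Local Notation X := (hyp_space f).
Implicit Types (P Q : affine_curve f).

Lemma xcoord_cvg P : xcoord p @[p --> (Some P : X)] --> xcoord (Some P : X).
Proof.
apply/cvgrPdist_lt => e e0; apply/nbhs_SomeP; exists e => // Q Q1 _.
by rewrite distrC.
Qed.

Lemma ycoord_cvg P : ycoord p @[p --> (Some P : X)] --> ycoord (Some P : X).
Proof.
apply/cvgrPdist_lt => e e0; apply/nbhs_SomeP; exists e => // Q _ Q2.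
by rewrite distrC.
Qed.

(** The coordinates take the default value 0 at infinity, so that point is excluded explicitly. *)
Lemma open_affine (h : X -> C) (O : set C) :
  (forall P, h p @[p --> (Some P : X)] --> h (Some P)) -> open O ->
  open [set p : X | p <> None /\ O (h p)].
Proof.
move=> ch oO; rewrite openE => -[P|[]//] [_ OhP] /=.
have h1 : nbhs (Some P : X) (h @^-1` O) by apply: ch; exact: open_nbhs_nbhs.
have h2 : nbhs (Some P : X) [set p | p <> None].
  by apply/nbhs_SomeP; exists (1 : C) => //; exact: ltr01.
by apply: filterS (filterI h2 h1).
Qed.

(** For x close to x(P), f(x) is close to y(P)^2, and openness of squaring yields a square root
    close to y(P). *)
Lemma xcoord_open P (W : set X) :
  nbhs (Some P : X) W -> nbhs (xcoord (Some P : X)) (@xcoord R f @` W).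
Proof.
move=> /nbhs_SomeP[e e0 eW].
have [|d d0 dy] := @horner_open C 'X^2 (set_val P).2 e _ e0.
  by rewrite size_polyXn.
have [e' e'0 fx] := @horner_close C f (set_val P).1 d d0.
have n1 : nbhs (set_val P).1 (ball (set_val P).1 e) by exact: nbhsx_ballx.
have n2 : nbhs (set_val P).1 (ball (set_val P).1 e') by exact: nbhsx_ballx.
apply: filterS (filterI n1 n2) => x; rewrite /ball /= => -[xe xe'].
have [|y yP y2] := dy f.[x].
  by rewrite hornerXn curveP; apply: fx; rewrite distrC.
have Q0 : affine_curve f (x, y) by rewrite /affine_curve /= -y2 hornerXn.
exists (Some (exist _ (x, y) (mem_set Q0))) => //.
by apply: eW => //=; rewrite distrC.
Qed.

(** For y close to y(P), y^2 is close to f(x(P)), and openness of f yields x close to x(P) with f(x)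
    = y^2. *)
Lemma ycoord_open P (W : set X) : (1 < size f)%N ->
  nbhs (Some P : X) W -> nbhs (ycoord (Some P : X)) (@ycoord R f @` W).
Proof.
move=> sf /nbhs_SomeP[e e0 eW].
have [d d0 dx] := @horner_open C f (set_val P).1 e sf e0.
have [e' e'0 fy] := @horner_close C 'X^2 (set_val P).2 d d0.
have n1 : nbhs (set_val P).2 (ball (set_val P).2 e) by exact: nbhsx_ballx.
have n2 : nbhs (set_val P).2 (ball (set_val P).2 e') by exact: nbhsx_ballx.
apply: filterS (filterI n1 n2) => y; rewrite /ball /= => -[ye ye'].
have [|x xP fx] := dx (y ^+ 2).
  by have := fy y; rewrite !hornerXn curveP; apply; rewrite distrC.
have Q0 : affine_curve f (x, y) by rewrite /affine_curve /= fx.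
exists (Some (exist _ (x, y) (mem_set Q0))) => //.
by apply: eW => //=; rewrite distrC.
Qed.

Lemma open_near (z e : C) : open [set w : C | `|w - z| < e].
Proof.
rewrite openE => w /= wz; apply/nbhs_normP; exists (e - `|w - z|).
  by rewrite /= subr_gt0.
move=> u; rewrite /ball_ /= ltrBrDr => h; apply: le_lt_trans h.
by rewrite [`|w - u|]distrC ler_distD.
Qed.

Lemma open_horner_neq0 (p : {poly C}) : open [set w : C | p.[w] != 0].
Proof.
rewrite openE => w /= pw.
have [|d d0 h] := @horner_close C p w `|p.[w]|; first by rewrite normr_gt0.
apply/nbhs_normP; exists d => // u; rewrite /ball_ /= distrC => /h.
by apply: contraTneq => ->; rewrite sub0r normrN ltxx.
Qed.

Lemma xchart_exists (p : X) : p <> None -> ycoord p != 0 ->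
  exists2 U : set X, U p & hyp_atlas g (U, @xcoord R f).
Proof.
case: p => [P _|//]; set y0 := ycoord _ => y0n.
(* The ball of radius |y0| around y0 avoids 0 and never contains both y and -y, so x is injective on
   [U]. *)
pose U : set X := [set p | p <> None /\ `|ycoord p - y0| < `|y0|].
have Un Q : U (Some Q) -> (set_val Q).2 != 0.
  by move=> [_]; apply: contraTneq => /= ->; rewrite sub0r normrN ltxx.
exists U; first by split => //=; rewrite subrr normr0 normr_gt0.
split; last first.
  by constructor 1; split => //= -[Q|] //; [move=> /Un|case].
apply: is_chart_local => /=.
- exact: (open_affine ycoord_cvg (@open_near y0 `|y0|)).
- move=> [P1|] [P2|]; rewrite !inE => -[n1 /= h1] [n2 /= h2];
    [|by case: n2|by case: n1|by case: n1].
  move=> x12; suff -> : P1 = P2 by []; apply: val_inj; move: h1 h2.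
  rewrite -!set_valE; move: (curveP P1) (curveP P2) x12.
  case: (set_val P1) => x y; case: (set_val P2) => x' y' /= c1 c2 e; subst x'.
  have /eqP : y ^+ 2 = y' ^+ 2 by rewrite c1.
  rewrite eqf_sqr => /orP[/eqP->//|/eqP->] h1 h2.
  (* Two opposite values in the ball would give |2 y0| < 2 |y0|. *)
  have := le_lt_trans (ler_normD _ _) (ltrD h1 h2).
  rewrite (_ : _ + _ = - (y0 *+ 2)); last by ring.
  by rewrite normrN normrMn mulr2n ltxx.
- move=> [p|] [nN _]; [exact: xcoord_cvg|by case: nN].
- move=> [p|] W [nN _]; [exact: xcoord_open|by case: nN].
Qed.

(** On a disc where f is injective, y determines f(x) = y^2 and thereby x. The conclusion avoids
    [hyp_atlas], so that the domain can also be pulled back to a chart with coordinate v. *)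
Lemma ychart_exists (p : X) :
  (1 < size f)%N -> p <> None -> f^`().[xcoord p] != 0 ->
  exists U : set X, [/\ U p, is_chart (U, @ycoord R f) &
    forall p', U p' -> p' <> None /\ f^`().[xcoord p'] != 0].
Proof.
move=> sf; case: p => [P _|//]; set x0 := xcoord _ => x0n.
have [e e0 inj] := horner_locally_inj x0n.
pose O := [set w : C | `|w - x0| < e] `&` [set w | f^`().[w] != 0].
pose U : set X := [set p | p <> None /\ O (xcoord p)].
exists U; split; first by split => //; split => //=; rewrite subrr normr0.
  apply: is_chart_local => /=.
  - apply: (open_affine xcoord_cvg).
    by apply: openI; [exact: open_near|exact: open_horner_neq0].
  - move=> [P1|] [P2|]; rewrite !inE => -[n1 [/= h1 _]] [n2 [/= h2 _]];
      [|by case: n2|by case: n1|by case: n1].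
    move=> y12; suff -> : P1 = P2 by []; apply: val_inj; move: h1 h2.
    rewrite -!set_valE; move: (curveP P1) (curveP P2) y12.
    case: (set_val P1) => x y; case: (set_val P2) => x' y' /= c1 c2 e'.
    subst y'.
    by move=> h1 h2; rewrite (inj x x')// -c1.
  - move=> [p|] [nN _]; [exact: ycoord_cvg|by case: nN].
  - move=> [p|] W [nN _]; [exact: ycoord_open|by case: nN].
by move=> p' [? []].
Qed.

End ChartConstruction.

(** * Points and convergence in terms of coordinates *)

Section Lifting.
Variable R : realType.
Local Notation C := (CC R).
Variable f : {poly C}.
Local Notation X := (hyp_space f).
Implicit Types (P Q : affine_curve f) (p : X).

(* Off the curve, None is a junk value. *)
Definition curve_point (z : C * C) : X :=
  if pselect (affine_curve f z) is left h then Some (exist _ z (mem_set h))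
  else None.

Lemma curve_pointP z : affine_curve f z ->
  exists2 Q, curve_point z = Some Q & set_val Q = z.
Proof.
by move=> fz; rewrite /curve_point; case: pselect => // h; eexists.
Qed.

Lemma curve_pointK P : curve_point (set_val P) = Some P.
Proof.
have [Q -> QP] := curve_pointP (curveP P); suff -> : Q = P by [].
by apply: val_inj; rewrite -!set_valE.
Qed.

(** On the affine part the topology is induced from C^2, so convergence of both coordinates is
    enough; staying away from infinity excludes the default values. *)
Lemma cvg_Some T (F : set_system T) {FF : Filter F} (h : T -> X) P :
  (\forall t \near F, h t <> None) ->
  xcoord (h t) @[t --> F] --> xcoord (Some P : X) ->
  ycoord (h t) @[t --> F] --> ycoord (Some P : X) ->
  h t @[t --> F] --> (Some P : X).
Proof.
move=> hN /cvgrPdist_lt hx /cvgrPdist_lt hy W /nbhs_SomeP[e e0 eW].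
refine (@filterS T F FF _ _ _ (filterI hN (filterI (hx e e0) (hy e e0)))).
move=> t [+ []] /=; case: (h t) => [Q _ Q1 Q2|//].
by apply: eW; rewrite distrC.
Qed.

Lemma cvg_None T (F : set_system T) {FF : Filter F} (h : T -> X) :
  (forall M : C, 0 < M ->
    \forall t \near F, h t = None \/ M < `|xcoord (h t)|) ->
  h t @[t --> F] --> (None : X).
Proof.
move=> hM W /nbhs_NoneP[W0 [M M0 MW]].
refine (@filterS T F FF _ _ _ (hM M M0)) => t /=.
by case: (h t) => [Q [//|/MW]|] //=.
Qed.

Lemma near_None (M : C) : 0 < M ->
  \forall p \near (None : X), p = None \/ M < `|xcoord p|.
Proof.
move=> M0; apply/nbhs_NoneP; split; first by left.
by exists M => // Q MQ; right.
Qed.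

Lemma near_Some P : \forall p \near (Some P : X), p <> None.
Proof. by apply/nbhs_SomeP; exists (1 : C) => //; exact: ltr01. Qed.

Lemma ycoord_sqr p : p <> None -> ycoord p ^+ 2 = f.[xcoord p].
Proof. by case: p => [P _|//]; exact: curveP. Qed.

Lemma point_eq p p' : p <> None -> p' <> None ->
  xcoord p = xcoord p' -> ycoord p = ycoord p' -> p = p'.
Proof.
case: p p' => [P|//] [P'|//] _ _ /= ex ey.
by rewrite -curve_pointK -[RHS]curve_pointK [set_val P]surjective_pairing ex ey
  -surjective_pairing.
Qed.

End Lifting.

(** * Pullback of charts along homeomorphisms *)

Section ChartPreimage.
Variable R : realType.
Local Notation C := (CC R).

Lemma is_chart_preimage (T T' : topologicalType) (h : T -> T') (h' : T' -> T)
    (c : set T' * (T' -> C)) :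
  cancel h h' -> cancel h' h -> continuous h -> continuous h' ->
  is_chart c -> is_chart (h @^-1` c.1, c.2 \o h).
Proof.
move=> hK h'K ch ch' [oc inj homeo]; split => /=.
- by move/continuousP : ch; apply.
- move=> x y; rewrite !inE /= => cx cy /inj e.
  by rewrite -[x]hK -[y]hK e// inE.
- move=> U Uc.
  have -> : (c.2 \o h) @` U = c.2 @` (h' @^-1` U).
    apply/seteqP; split => [_ [x Ux <-]|_ [x Ux <-]].
      by exists (h x) => //=; rewrite hK.
    by exists (h' x) => //=; rewrite h'K.
  have -> : open U <-> open (h' @^-1` U).
    split => [|oU]; first by move/continuousP : ch'; apply.
    rewrite (_ : U = h @^-1` (h' @^-1` U)).
      by move/continuousP : ch; apply.
    by apply/funext => x /=; rewrite hK.
  by apply: homeo => x /= /Uc /=; rewrite h'K.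
Qed.

End ChartPreimage.

(** * The palindromic polynomial and its simple roots *)

Section Palindromic.
Variables (K : numFieldType) (q : nat) (k : K).

(** [model_poly] with its middle coefficient as a parameter; the two agree by conversion for k = 2
    (1 + lambda) / (1 - lambda). *)
Definition palindromic_poly : {poly K} := 'X * ('X^(2 * q) + k *: 'X^q + 1).
Local Notation f := palindromic_poly.

Lemma horner_palindromic x : f.[x] = x * (x ^+ (2 * q) + k * x ^+ q + 1).
Proof. by rewrite /f !hornerE. Qed.

Lemma coef_palindromic i :
  f`_i = (i == (2 * q).+1)%:R + k * (i == q.+1)%:R + (i == 1)%:R.
Proof.
rewrite /f coefXM; case: i => [|i] /=; first by rewrite mulr0 !addr0.
by rewrite !coefD coefZ !coefXn coef1 !eqSS.
Qed.

Hypothesis q0 : (0 < q)%N.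

Lemma horner_deriv_palindromic x :
  f^`().[x] = (2 * q).+1%:R * x ^+ (2 * q) + k * (q.+1%:R * x ^+ q) + 1.
Proof.
(* The factor x turns the exponent n - 1 of the derivative into n, which avoids truncated
   subtraction in the formula. *)
have e n : x * ('X^n)^`().[x] = n%:R * x ^+ n.
  rewrite derivXn hornerMn hornerXn -mulr_natl mulrCA; case: n => [|n].
    by rewrite !mul0r.
  by rewrite exprS.
rewrite /f derivM derivX mul1r !derivD derivZ derivC addr0.
rewrite !(hornerD, hornerM, hornerZ, hornerX, hornerXn, hornerC).
rewrite mulrDr e [x * (k * _)]mulrCA e -!natr1 natrM.
ring.
Qed.

Lemma size_palindromic : size f = (2 * q).+2.
Proof.
apply/anti_leq/andP; split.
  apply/leq_sizeP => i qi; rewrite coef_palindromic.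
  have -> : (i == (2 * q).+1) = false by apply/eqP; lia.
  have -> : (i == q.+1) = false by apply/eqP; lia.
  have -> : (i == 1%N) = false by apply/eqP; lia.
  by rewrite mulr0 !addr0.
rewrite ltnNge; apply/negP => /leq_sizeP/(_ _ (leqnn _))/eqP.
rewrite coef_palindromic eqxx.
have -> : ((2 * q).+1 == q.+1) = false by apply/eqP; lia.
have -> : ((2 * q).+1 == 1%N) = false by apply/eqP; lia.
by rewrite mulr0 !addr0 oner_eq0.
Qed.

(** Two distinct roots of T^2 + k T + 1 have product 1, whereas 2^q 3^q != 1. So 2 or 3 is not a
    root of f, which provides a point with |x| > 1 and y != 0. *)
Lemma palindromic_root23 : f.[2] = 0 -> f.[3] = 0 -> False.
Proof.
have n2 : 2 != 0 :> K by rewrite pnatr_eq0.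
have n3 : 3 != 0 :> K by rewrite pnatr_eq0.
rewrite !horner_palindromic => /eqP + /eqP; rewrite [(2 * q)%N]mulnC !exprM.
rewrite !mulf_eq0 (negPf n2) (negPf n3) /=.
have : 2 ^+ q != 3 ^+ q :> K by rewrite -!natrX eqr_nat eqn_exp2r.
have : 2 ^+ q * 3 ^+ q != 1 :> K.
  rewrite -exprMn -natrM -natrX -[1]/(1%:R) eqr_nat -[1%N](exp1n q).
  by rewrite eqn_exp2r.
move: (2 ^+ q) (3 ^+ q) => t u tu1 tu /eqP f2 /eqP f3.
have /eqP : (t - u) * (t + u + k) = 0.
  transitivity (t ^+ 2 + k * t + 1 - (u ^+ 2 + k * u + 1)); first by ring.
  by rewrite f2 f3 subr0.
rewrite mulf_eq0 subr_eq0 (negPf tu) /= addrC addr_eq0 => /eqP ek.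
move/negP: tu1; apply; rewrite -subr_eq0 -oppr_eq0 -[X in _ == X]f2 ek.
by apply/eqP; ring.
Qed.

Hypothesis k2 : k ^+ 2 != 4%:R.

(** At x = 0 the derivative is 1. Otherwise t = x^q is a root of T^2 + k T + 1 and f'(x) = q t (2 t
    + k); if this vanished, then k = -2 t, t^2 = 1 and k^2 = 4. *)
Lemma palindromic_simple_root x : f.[x] = 0 -> f^`().[x] != 0.
Proof.
rewrite horner_palindromic horner_deriv_palindromic => /eqP.
rewrite mulf_eq0 => /orP[/eqP->|/eqP h].
  by rewrite !expr0n muln_eq0 /= eqn0Ngt q0 /= !mulr0 !add0r oner_eq0.
apply: contra_neq k2; move: h; rewrite mulnC exprM; move: (x ^+ q) => t h h'.
have t0 : t != 0.
  by apply: contra_eq_neq h => ->; rewrite expr0n mulr0 !add0r oner_eq0.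
have /eqP : q%:R * t * (t *+ 2 + k) = 0.
  transitivity ((q * 2).+1%:R * t ^+ 2 + k * (q.+1%:R * t) + 1
    - (t ^+ 2 + k * t + 1)); last by rewrite h h' subr0.
  by rewrite -!natr1 natrM; ring.
rewrite !mulf_eq0 pnatr_eq0 (negPf t0) eqn0Ngt q0 /= addrC addr_eq0 => /eqP ek.
have t2 : t ^+ 2 = 1.
  apply/eqP; rewrite -subr_eq0; apply/eqP.
  transitivity (- (t ^+ 2 + k * t + 1)); last by rewrite h oppr0.
  by rewrite ek; ring.
by rewrite ek sqrrN -mulr_natl exprMn t2 mulr1 -natrX.
Qed.

End Palindromic.

(** Reversal sends the exponent i to 2 q + 2 - i, which exchanges 1 and 2 q + 1 and fixes q + 1. The
    curve at infinity thus has the same equation as the affine one. *)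
Lemma palindromic_at_infinity (R : realType) (q : nat) (k : CC R) : (0 < q)%N ->
  poly_at_infinity (palindromic_poly q k) q = palindromic_poly q k.
Proof.
move=> q0; apply/polyP => i; rewrite coef_poly; case: ltnP => iq.
  rewrite !coef_palindromic.
  have -> : ((2 * q + 2 - i)%N == (2 * q).+1) = (i == 1%N).
    by apply/eqP/eqP; lia.
  have -> : ((2 * q + 2 - i)%N == q.+1) = (i == q.+1) by apply/eqP/eqP; lia.
  have -> : ((2 * q + 2 - i)%N == 1%N) = (i == (2 * q).+1).
    by apply/eqP/eqP; lia.
  ring.
by rewrite nth_default// size_palindromic; lia.
Qed.

(** * The maps r^i and s on the curve and their continuity *)

Section Automorphisms.
Variable R : realType.
Local Notation C := (CC R).
Variables (q : nat) (k : C).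
Hypothesis q0 : (0 < q)%N.
Local Notation f := (palindromic_poly q k).
Local Notation X := (hyp_space f).
Implicit Types (P Q : affine_curve f) (p : X) (z : C).

(* r^i, parametrized by z = omega_(2q)^i *)
Definition rotation z p : X :=
  if p is Some P then curve_point f (z ^+ 2 * (set_val P).1, z * (set_val P).2)
  else None.

Definition inversion p : X :=
  if p is Some P then
    if (set_val P).1 == 0 then None
    else curve_point f
      (1 / (set_val P).1, (set_val P).2 / (set_val P).1 ^+ q.+1)
  else curve_point f (0, 0).

Lemma unity_neq0 z : z ^+ (2 * q) = 1 -> z != 0.
Proof.
apply: contra_eq_neq => ->.
by rewrite expr0n muln_eq0 /= gtn_eqF// eq_sym oner_neq0.
Qed.

(** For w = z^2 one has w^q = w^(2q) = 1, hence f(w x) = w f(x) = z^2 f(x). *)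
Lemma rotation_curve z P : z ^+ (2 * q) = 1 ->
  affine_curve f (z ^+ 2 * (set_val P).1, z * (set_val P).2).
Proof.
move=> zq; rewrite /affine_curve /= exprMn curveP !horner_palindromic.
have := exprAC z 2 (2 * q); have := exprM z 2 q; rewrite zq expr1n.
move: (z ^+ 2) => w wq w2q.
by rewrite [(w * _) ^+ _]exprMn [(w * _) ^+ q]exprMn w2q -wq !mul1r mulrA.
Qed.

(** Palindromicity gives f(1/x) = f(x) / x^(2q+2). *)
Lemma inversion_curve P : (set_val P).1 != 0 ->
  affine_curve f (1 / (set_val P).1, (set_val P).2 / (set_val P).1 ^+ q.+1).
Proof.
move=> x0; rewrite /affine_curve /= expr_div_n curveP !horner_palindromic.
move: (set_val P).1 x0 => x x0.
rewrite div1r [x ^+ q.+1]exprS !exprVn [(2 * q)%N]mulnC !exprM.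
have : x ^+ q != 0 by rewrite expf_neq0.
by move: (x ^+ q) => t t0; field; rewrite ?t0 ?x0.
Qed.

Lemma origin_curve : affine_curve f (0, 0).
Proof.
by rewrite /affine_curve /= horner_palindromic mul0r expr0n.
Qed.

Lemma ycoord0 p : xcoord p = 0 -> ycoord p = 0.
Proof.
case: p => [P|//] /= x0; apply/eqP; rewrite -sqrf_eq0 curveP.
by rewrite horner_palindromic x0 mul0r.
Qed.

Lemma rotation_Some z P : z ^+ (2 * q) = 1 -> rotation z (Some P) <> None.
Proof. by move=> /rotation_curve-/(_ P)/curve_pointP[Q /= ->]. Qed.

Lemma rotation_neq z p : z ^+ (2 * q) = 1 -> rotation z p <> None <-> p <> None.
Proof.
by move=> zq; case: p => [P|//]; split => // _; exact: rotation_Some.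
Qed.

Lemma xcoord_rotation z p : z ^+ (2 * q) = 1 ->
  xcoord (rotation z p) = z ^+ 2 * xcoord p.
Proof.
move=> zq; case: p => [P|] /=; last by rewrite mulr0.
by have [Q -> /= ->] := curve_pointP (rotation_curve P zq).
Qed.

Lemma ycoord_rotation z p : z ^+ (2 * q) = 1 ->
  ycoord (rotation z p) = z * ycoord p.
Proof.
move=> zq; case: p => [P|] /=; last by rewrite mulr0.
by have [Q -> /= ->] := curve_pointP (rotation_curve P zq).
Qed.

(** As z^(2q) = 1, the factor of y / x^(q+1) is z / z^(2q+2) = z^-1. *)
Lemma vcoord_rotation z p : z ^+ (2 * q) = 1 ->
  vcoord q (rotation z p) = z^-1 * vcoord q p.
Proof.
move=> zq; rewrite /vcoord xcoord_rotation// ycoord_rotation//.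
have z0 := unity_neq0 zq.
rewrite exprMn -exprM mulnS exprD zq mulr1 invfM expr2 invfM.
by rewrite mulrACA [z * _]mulrA mulfV// mul1r.
Qed.

Lemma rotationM z w p : z ^+ (2 * q) = 1 -> w ^+ (2 * q) = 1 ->
  rotation z (rotation w p) = rotation (z * w) p.
Proof.
move=> zq wq; have zwq : (z * w) ^+ (2 * q) = 1 by rewrite exprMn zq wq mulr1.
case: p => [P|//]; apply: point_eq.
- by rewrite !rotation_neq.
- by rewrite rotation_neq.
- by rewrite !xcoord_rotation// exprMn mulrA.
- by rewrite !ycoord_rotation// mulrA.
Qed.

Lemma rotation1 p : rotation 1 p = p.
Proof.
case: p => [P|//]; apply: point_eq => //.
- by rewrite rotation_neq// expr1n.
- by rewrite xcoord_rotation ?expr1n// mul1r.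
- by rewrite ycoord_rotation ?expr1n// mul1r.
Qed.

(** With x = 0 by default at infinity and 0^-1 = 0 by convention, the identity extends to the origin
    and to infinity, which s exchanges. *)
Lemma xcoord_inversion p : xcoord (inversion p) = (xcoord p)^-1.
Proof.
case: p => [P|] /=; last first.
  by have [Q -> /= ->] := curve_pointP origin_curve; rewrite invr0.
have [->|x0] := eqVneq; first by rewrite invr0.
by have [Q -> /= ->] := curve_pointP (inversion_curve x0); rewrite /= div1r.
Qed.

Lemma ycoord_inversion p : ycoord (inversion p) = vcoord q p.
Proof.
case: p => [P|] /=; last first.
  by have [Q -> /= ->] := curve_pointP origin_curve; rewrite /vcoord mul0r.
have [x0|x0] := eqVneq.
  by rewrite /vcoord (ycoord0 (p := Some P)) ?mul0r.
by have [Q -> /= ->] := curve_pointP (inversion_curve x0).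
Qed.

Lemma vcoord_inversion p : vcoord q (inversion p) = ycoord p.
Proof.
rewrite /vcoord ycoord_inversion xcoord_inversion /vcoord exprVn invrK.
have [x0|x0] := eqVneq (xcoord p) 0; first by rewrite ycoord0// !mul0r.
by rewrite divfK// expf_neq0.
Qed.

Lemma inversion_None p : inversion p = None <-> p <> None /\ xcoord p = 0.
Proof.
case: p => [P|] /=; last first.
  by have [Q -> _] := curve_pointP origin_curve; split => // -[].
have [x0|x0] := eqVneq; first by split.
have [Q -> _] := curve_pointP (inversion_curve x0); split => // -[_ /eqP].
by rewrite (negPf x0).
Qed.

Lemma inversionK : involutive inversion.
Proof.
move=> p; have [N|N] := pselect (inversion p = None).
  rewrite N; have [pN x0] := (inversion_None p).1 N.
  have [Q /= e QP] := curve_pointP origin_curve; rewrite e.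
  by apply: point_eq => //=; rewrite QP//= ?ycoord0.
have [->|pN] := pselect (p = None).
  apply/inversion_None; split; first by move/inversion_None => [].
  by rewrite xcoord_inversion invr0.
apply: point_eq => //.
- rewrite inversion_None => -[_]; rewrite xcoord_inversion => /eqP.
  by rewrite invr_eq0 => /eqP x0; apply: N; apply/inversion_None.
- by rewrite !xcoord_inversion invrK.
- by rewrite ycoord_inversion vcoord_inversion.
Qed.

Lemma rotation_continuous z : z ^+ (2 * q) = 1 -> continuous (rotation z).
Proof.
move=> zq [P|].
  case e : (rotation z (Some P)) => [Q|]; last by case: (rotation_Some zq e).
  rewrite /continuous_at e.
  apply: (@cvg_Some _ _ _ (nbhs (Some P : X)) _ (rotation z) Q); rewrite -?e.
  - by apply: filterS (near_Some P) => p pN; rewrite rotation_neq.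
  - rewrite xcoord_rotation//.
    under eq_fun do rewrite xcoord_rotation//.
    by apply: cvgM; [exact: cvg_cst|exact: xcoord_cvg].
  - rewrite ycoord_rotation//.
    under eq_fun do rewrite ycoord_rotation//.
    by apply: cvgM; [exact: cvg_cst|exact: ycoord_cvg].
apply: (@cvg_None _ _ _ (nbhs (None : X)) _ (rotation z)) => M M0.
(* A root of unity has modulus 1, so the neighbourhoods |x| > M of infinity are preserved. *)
have z1 : `|z| = 1.
  apply/eqP; rewrite -(@pexpr_eq1 _ _ (2 * q)) ?muln_gt0//.
  by rewrite -normrX zq normr1.
apply: filterS (near_None f M0) => p [->|xp]; [by left|right].
by rewrite xcoord_rotation// normrM normrX z1 expr1n mul1r.
Qed.

Lemma inversion_continuous : continuous inversion.
Proof.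
move=> [P|]; last first.
  rewrite /continuous_at /=; have [Q -> Q0] := curve_pointP origin_curve.
  have x0 : xcoord (inversion p) @[p --> (None : X)] --> (0 : C).
    refine ((@cvgrPdist_lt _ _ _ _ (nbhs_filter (None : X)) _ _).2 _) => e e0.
    have ie0 : 0 < e^-1 by rewrite invr_gt0.
    apply: filterS (near_None f ie0) => p [->|xp].
      by rewrite xcoord_inversion invr0 subrr normr0.
    rewrite xcoord_inversion sub0r normrN normfV invf_plt// posrE//.
    exact: lt_trans xp.
  have nN : \forall p \near (None : X), inversion p <> None.
    apply: filterS (near_None f (@ltr01 C)) => p [-> /inversion_None[]//|x1].
    by move=> /inversion_None[_ x0']; move: x1; rewrite x0' normr0 ltr10.
  apply: (@cvg_Some _ _ _ (nbhs (None : X)) _ inversion Q); first exact: nN.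
  - by rewrite /= Q0.
  - suff : ycoord (inversion p) @[p --> (None : X)] --> (0 : C).
      by rewrite /= Q0.
    refine ((@cvgrPdist_lt _ _ _ _ (nbhs_filter (None : X)) _ _).2 _) => e e0.
    (* The square of y is f(x), which tends to f(0) = 0; the tolerance e^2 for it gives e for y. *)
    have fx : f.[xcoord (inversion p)] @[p --> (None : X)] --> f.[0].
      exact: (@horner_cvg C f X (nbhs (None : X)) _
        (fun p => xcoord (inversion p)) 0 x0).
    move: fx; rewrite horner_palindromic mul0r => /cvgrPdist_lt/(_ (e ^+ 2)).
    rewrite exprn_gt0// => /(_ isT) fx.
    apply: filterS (filterI nN fx) => p [pN].
    rewrite !sub0r !normrN -ycoord_sqr//.
    by rewrite normrX ltr_pXn2r// nnegrE ltW.
(* At the origin, 0 < |x| < 1/M makes |1/x| > M, and points with x = 0 go to infinity. Elsewhere the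
   coordinates of the image are continuous. *)
have [x0|x0] := eqVneq (set_val P).1 0.
  rewrite /continuous_at.
  have -> : inversion (Some P) = None by apply/inversion_None.
  apply: (@cvg_None _ _ _ (nbhs (Some P : X)) _ inversion) => M M0.
  have /cvgrPdist_lt/(_ M^-1) := @xcoord_cvg _ f P.
  rewrite invr_gt0 => /(_ M0) h; apply: filterS (filterI (near_Some P) h) => p.
  rewrite /= x0 sub0r normrN => -[pN {}h].
  have [p0|p0] := eqVneq (xcoord p) 0.
    by left; apply/inversion_None.
  right; rewrite xcoord_inversion normfV.
  by rewrite -[M]invrK ltf_pV2// posrE ?invr_gt0// normr_gt0.
case e : (inversion (Some P)) => [Q|]; last first.
  by move/inversion_None : e => -[_ /eqP]; rewrite (negPf x0).
have ix : (xcoord p)^-1 @[p --> (Some P : X)] --> (xcoord (Some P : X))^-1.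
  by apply: cvgV => //; exact: xcoord_cvg.
rewrite /continuous_at e.
apply: (@cvg_Some _ _ _ (nbhs (Some P : X)) _ inversion Q); rewrite -?e.
- have /cvgrPdist_lt/(_ `|(set_val P).1|) := @xcoord_cvg _ f P.
  rewrite normr_gt0 => /(_ x0); apply: filterS => p h /inversion_None[_ p0].
  by move: h; rewrite p0 subr0 ltxx.
- rewrite xcoord_inversion.
  by under eq_fun do rewrite xcoord_inversion.
- rewrite ycoord_inversion.
  under eq_fun do rewrite ycoord_inversion.
  rewrite /vcoord -exprVn.
  under eq_fun do rewrite -exprVn.
  apply: cvgM; first exact: ycoord_cvg.
  exact: (@exprn_cvg C X (nbhs (Some P : X)) _
    (fun p => (xcoord p)^-1) _ q.+1 ix).
Qed.

End Automorphisms.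

(** * Atlas of the model and holomorphy of r and s *)

Section HolomorphicAutomorphisms.
Variable R : realType.
Local Notation C := (CC R).
Variables (q : nat) (k : C).
Hypothesis q0 : (0 < q)%N.
Hypothesis k2 : k ^+ 2 != 4%:R.
Local Notation f := (palindromic_poly q k).
Local Notation X := (hyp_space f).
Local Notation M := (hyp_surface f q).
Local Notation inversion := (@inversion R q k).
Local Notation rotation := (@rotation R q k).
Implicit Types (P Q : affine_curve f) (p : X) (z : C).

(** Since v = y o s, the preimage under s of a y-chart at s(p) is a v-chart at p. Infinity carries
    no condition because it goes to the origin, where f' = 1. *)
Lemma vchart_exists p :
  (p <> None -> xcoord p != 0 /\ f^`().[(xcoord p)^-1] != 0) ->
  exists2 U : set X, U p & hyp_atlas q (U, @vcoord R f q).
Proof.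
move=> hp.
have sp : inversion p <> None.
  by move/inversion_None => [/hp[/eqP]].
have f's : f^`().[xcoord (inversion p)] != 0.
  rewrite xcoord_inversion.
  have [->|/hp[]//] := pselect (p = None).
  rewrite invr0 horner_deriv_palindromic// !expr0n muln_eq0 /= gtn_eqF//.
  by rewrite !mulr0 !add0r oner_neq0.
have [|U [Us cU condU]] := ychart_exists _ sp f's.
  by rewrite size_palindromic.
exists (inversion @^-1` U) => //; split => /=.
  have -> : @vcoord R f q = @ycoord R f \o inversion.
    by apply/funext => x /=; rewrite ycoord_inversion.
  by apply: (is_chart_preimage (h' := inversion) _ _ _ _ cU) => //;
    solve [exact: inversionK | exact: inversion_continuous].
constructor 3; split => // p' /= /condU[sp' f's'] p'N.
split; first by apply/eqP => x0; apply: sp'; apply/inversion_None.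
by rewrite palindromic_at_infinity// -xcoord_inversion.
Qed.

Lemma ychart_exists_model p : p <> None -> f^`().[xcoord p] != 0 ->
  exists2 U : set X, U p & hyp_atlas q (U, @ycoord R f).
Proof.
move=> pN f'p.
have [|U [Up cU condU]] := ychart_exists _ pN f'p.
  by rewrite size_palindromic.
by exists U => //; split => //; constructor 2.
Qed.

Lemma charted_model : charted M.
Proof.
split; last by move=> c [].
move=> p; have [->|pN] := pselect (p = None).
  by have [|U U0 aU] := @vchart_exists None; [|exists (U, @vcoord R f q)].
have [y0|y0] := eqVneq (ycoord p) 0; last first.
  by have [U Up aU] := xchart_exists q pN y0; exists (U, @xcoord R f).
have [||U Up aU] := @ychart_exists_model p => //;
  last by exists (U, @ycoord R f).
by apply: palindromic_simple_root => //; rewrite -ycoord_sqr// y0 expr0n.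
Qed.

Hypothesis holo_id : holomorphic (@id M).

(** Compatibility of the charts, encoded in [holo_id], makes x, y and v holomorphic wherever they
    are local coordinates. *)
Lemma holo_coordinate (c d : set M * (M -> C)) p :
  atlas c -> atlas d -> c.1 p -> d.1 p -> holo_at c d.2 p.
Proof. by move=> ac ad cp dp; exact: (holo_id.2 c d p). Qed.

Lemma holo_xcoord (c : set M * (M -> C)) p : atlas c -> c.1 p ->
  p <> None -> ycoord p != 0 -> holo_at c (@xcoord R f) p.
Proof.
move=> ac cp pN y0; have [U Up aU] := xchart_exists q pN y0.
exact: (holo_coordinate ac aU cp Up).
Qed.

Lemma holo_ycoord (c : set M * (M -> C)) p : atlas c -> c.1 p ->
  p <> None -> f^`().[xcoord p] != 0 -> holo_at c (@ycoord R f) p.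
Proof.
move=> ac cp pN f'p; have [U Up aU] := ychart_exists_model pN f'p.
exact: (holo_coordinate ac aU cp Up).
Qed.

Lemma holo_vcoord (c : set M * (M -> C)) p : atlas c -> c.1 p ->
  (p <> None -> xcoord p != 0 /\ f^`().[(xcoord p)^-1] != 0) ->
  holo_at c (@vcoord R f q) p.
Proof.
move=> ac cp hp; have [U Up aU] := vchart_exists hp.
exact: (holo_coordinate ac aU cp Up).
Qed.

Lemma holo_scale (c : set M * (M -> C)) (g : M -> C) (a : C) p :
  atlas c -> c.1 p -> holo_at c g p -> holo_at c (fun x => a * g x) p.
Proof.
move=> ac cp.
refine (@holo_at_post R M c g (fun w => a * w) p (charted_model.2 c ac) cp _).
by apply: derivableM; [exact: derivable_cst|exact: derivable_id].
Qed.

(** Only the exponents 0, q and 2q occur in f', and z^2 is a q-th root of unity. *)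
Lemma deriv_rotation z x : z ^+ (2 * q) = 1 -> f^`().[z ^+ 2 * x] = f^`().[x].
Proof.
move=> zq; rewrite !horner_deriv_palindromic//.
have := exprAC z 2 (2 * q); have := exprM z 2 q; rewrite zq expr1n.
move: (z ^+ 2) => w wq w2q.
by rewrite [(w * _) ^+ _]exprMn [(w * _) ^+ q]exprMn w2q -wq !mul1r.
Qed.

Lemma rotation_holomorphic z : z ^+ (2 * q) = 1 ->
  holomorphic (rotation z : M -> M).
Proof.
move=> zq; split; first exact: rotation_continuous.
have z0 := unity_neq0 q0 zq.
move=> c d p ac [_ ad] cp dp.
(* According to the target chart, the coordinate x, y or v is multiplied by z^2, z or z^-1, and the
   chart condition at the image carries over to [p]. *)
case: ad => -[-> cond]; have := cond _ dp.
- move=> [/rotation_neq-/(_ zq) pN].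
  rewrite ycoord_rotation// mulf_eq0 (negPf z0) /= => y0.
  rewrite (_ : _ \o _ = fun x => z ^+ 2 * xcoord x); last first.
    by apply/funext => x /=; rewrite xcoord_rotation.
  by apply: holo_scale => //; exact: holo_xcoord.
- move=> [/rotation_neq-/(_ zq) pN].
  rewrite xcoord_rotation// deriv_rotation// => f'p.
  rewrite (_ : _ \o _ = fun x => z * ycoord x); last first.
    by apply/funext => x /=; rewrite ycoord_rotation.
  by apply: holo_scale => //; exact: holo_ycoord.
- rewrite palindromic_at_infinity// xcoord_rotation// => h.
  rewrite (_ : _ \o _ = fun x => z^-1 * vcoord q x); last first.
    by apply/funext => x /=; rewrite vcoord_rotation.
  apply: holo_scale => //; apply: holo_vcoord => // pN.
  have [|] := h; first exact/rotation_neq.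
  rewrite mulf_eq0 sqrf_eq0 (negPf z0) /= invfM => ->.
  by rewrite -exprVn deriv_rotation// exprVn zq invr1.
Qed.

Lemma inversion_holomorphic : holomorphic (inversion : M -> M).
Proof.
split; first exact: inversion_continuous.
move=> c d p ac [_ ad] cp dp.
case: ad => -[-> cond]; have := cond _ dp.
- rewrite ycoord_inversion /vcoord mulf_eq0 negb_or => -[_ /andP[y0 x0]].
  (* The inverse of 0 is 0, so v(p) != 0 forces x(p) != 0; this also rules out infinity, where x is
     0 by default. *)
  have {}x0 : xcoord p != 0 by apply: contraNneq x0 => ->; rewrite expr0n invr0.
  have pN : p <> None by move=> pN; move: x0; rewrite pN eqxx.
  have cc := charted_model.2 _ ac.
  rewrite (_ : _ \o _ = (fun w => w^-1) \o @xcoord R f); last first.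
    by apply/funext => x /=; rewrite xcoord_inversion.
  refine (@holo_at_post R M c (@xcoord R f) (fun w => w^-1) p cc cp _ _).
    by apply: derivableV => //; exact: derivable_id.
  exact: holo_xcoord.
- rewrite xcoord_inversion => -[sN f's].
  rewrite (_ : _ \o _ = @vcoord R f q); last first.
    by apply/funext => x /=; rewrite ycoord_inversion.
  apply: holo_vcoord => // pN; split => //.
  by apply/eqP => x0; apply: sN; apply/inversion_None.
- rewrite palindromic_at_infinity// xcoord_inversion invrK => h.
  rewrite (_ : _ \o _ = @ycoord R f); last first.
    by apply/funext => x /=; rewrite vcoord_inversion.
  have pN : p <> None.
    move=> pN; have [|] := h; first by rewrite pN => /inversion_None[].
    by rewrite pN /= invr0 eqxx.
  apply: holo_ycoord => //.
  (* The origin goes to infinity, where the condition on a v-chart is void; there f'(0) = 1 is used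
     instead. *)
  have [x0|x0] := eqVneq (xcoord p) 0.
    rewrite x0 horner_deriv_palindromic// !expr0n muln_eq0 /= gtn_eqF//.
    by rewrite !mulr0 !add0r oner_neq0.
  have [|//] := h; move=> /inversion_None[_ /eqP]; rewrite (negPf x0)//.
Qed.

Lemma rotation_Aut z : z ^+ (2 * q) = 1 -> @Aut R M (rotation z).
Proof.
move=> zq; have ziq : z^-1 ^+ (2 * q) = 1 by rewrite exprVn zq invr1.
have z0 := unity_neq0 q0 zq.
split; first exact: rotation_holomorphic.
exists (rotation z^-1); split; last exact: rotation_holomorphic.
  by move=> p; rewrite rotationM// mulVf// rotation1.
by move=> p; rewrite rotationM// mulfV// rotation1.
Qed.

Lemma inversion_Aut : @Aut R M inversion.
Proof.
split; first exact: inversion_holomorphic.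
by exists inversion; split;
  [exact: inversionK|exact: inversionK|exact: inversion_holomorphic].
Qed.

End HolomorphicAutomorphisms.

(** * Distinctness of the powers of exp(2 pi i / n) *)

Section RootsOfUnity.
Variable R : realType.
Local Notation C := (CC R).

Lemma cisD (a b : R) : cis (a + b) = cis a * cis b :> C.
Proof. by rewrite /cis cosD sinD; simpc; rewrite [X in (_ +i* X)%C]addrC. Qed.

Lemma cisX (a : R) n : cis (n%:R * a) = cis a ^+ n :> C.
Proof.
elim: n => [|n IH]; first by rewrite mul0r /cis cos0 sin0.
by rewrite -natr1 mulrDl mul1r cisD IH exprSr.
Qed.

(** By the half-angle formula 1 - cos a = 2 sin(a/2)^2, and sin(a/2) > 0 for 0 < a < 2 pi. *)
Lemma cis_eq1 (a : R) : 0 <= a -> a < 2 * pi -> cis a = 1 :> C -> a = 0.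
Proof.
move=> a0 a2pi [ca _].
have [//|an0] := eqVneq a 0.
have : 0 < sin (a / 2).
  apply: sin_gt0_pi; apply/andP; split; first by rewrite divr_gt0// lt_def an0.
  by rewrite ltr_pdivrMr// mulrC.
have : cos (a / 2 + a / 2) = 1 - 2 * sin (a / 2) ^+ 2.
  by rewrite cosD -!expr2 cos2sin2; ring.
rewrite -splitr ca => h s0.
have : sin (a / 2) ^+ 2 = 0 by lra.
by move/eqP; rewrite sqrf_eq0 (gt_eqF s0).
Qed.

Lemma omega_expr (n : nat) : (0 < n)%N -> omega R n ^+ n = 1.
Proof.
move=> n0; rewrite /omega -cisX mulrC divfK ?pnatr_eq0 -?lt0n//.
by rewrite /cis mulr_natl cos2pi sin2pi.
Qed.

Lemma omega_double (n : nat) : (0 < n)%N -> omega R (2 * n) ^+ 2 = omega R n.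
Proof.
move=> n0; rewrite /omega -cisX natrM; congr (cis _ : C).
by field; rewrite pnatr_eq0 -lt0n.
Qed.

Lemma omega_neq0 (n : nat) : (0 < n)%N -> omega R n != 0.
Proof.
move=> n0; apply: contra_eq_neq (omega_expr n0) => ->.
by rewrite expr0n gtn_eqF// eq_sym oner_neq0.
Qed.

Lemma omega_inj (n i j : nat) : (i < n)%N -> (j < n)%N ->
  omega R n ^+ i = omega R n ^+ j -> i = j.
Proof.
wlog ij : i j / (i <= j)%N.
  move=> h; have [/h//|/ltnW/h ji] := leqP i j => hi hj e.
  exact/esym/ji.
move=> _ jn e; have n0 : (0 < n)%N by exact: leq_ltn_trans jn.
have : omega R n ^+ (j - i) = 1.
  apply: (mulfI (expf_neq0 i (omega_neq0 n0))).
  by rewrite -exprD subnKC// mulr1.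
(* [a] is the angle 2 pi (j - i) / n, which lies in [0, 2 pi) and is therefore 0 by [cis_eq1]. *)
rewrite /omega -cisX; set a := _ * _ => a1.
have pi0 : 0 < pi :> R := pi_gt0 R.
have nn : 0 < n%:R :> R by rewrite ltr0n.
have a0 : 0 <= a by rewrite mulr_ge0// divr_ge0 ?ltW// mulr_gt0.
have a2 : a < 2 * pi.
  rewrite /a mulrCA gtr_pMr; last by rewrite mulr_gt0.
  by rewrite ltr_pdivrMr// mul1r ltr_nat (leq_ltn_trans (leq_subr _ _)).
move: (cis_eq1 a0 a2 a1) => /eqP; rewrite /a.
rewrite !mulf_eq0 invr_eq0 !pnatr_eq0 (gt_eqF pi0) (gtn_eqF n0) /= !orbF => ji.
by apply/eqP; rewrite eqn_leq ij -subn_eq0.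
Qed.

End RootsOfUnity.

(** * Counting: r and s generate all automorphisms *)

Section Counting.
Variable R : realType.
Local Notation C := (CC R).
Variables (q : nat) (k : C).
Hypothesis q0 : (0 < q)%N.
Hypothesis k2 : k ^+ 2 != 4%:R.
Local Notation f := (palindromic_poly q k).
Local Notation X := (hyp_space f).
Local Notation M := (hyp_surface f q).
Local Notation inversion := (@inversion R q k).
Local Notation rotation := (@rotation R q k).
Local Notation w := (omega R (2 * q)).

Let qq0 : (0 < 2 * q)%N.
Proof. by rewrite muln_gt0. Qed.

(* At this point the y-coordinate separates the powers of r, and |x| separates
   them from the elements s r^i. *)
Lemma generic_point : exists p : X, 1 < `|xcoord p| /\ ycoord p != 0.
Proof.
have pt (x : C) : 1 < `|x| -> f.[x] != 0 ->
    exists p : X, 1 < `|xcoord p| /\ ycoord p != 0.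
  move=> x1 fx; have [|P _ PE] := @curve_pointP R f (x, sqrtC f.[x]).
    by rewrite /affine_curve /= sqrtCK.
  by exists (Some P); rewrite /= PE /= sqrtC_eq0.
have [f2|] := eqVneq f.[2] 0; last by apply: pt; rewrite normr_nat ltr1n.
apply: (pt 3); first by rewrite normr_nat ltr1n.
by apply/eqP => f3; exact: (palindromic_root23 q0 f2 f3).
Qed.

(* r^n for n < 2q and s r^(n - 2q) for 2q <= n < 4q *)
Definition dihedral_elt (n : nat) : M -> M :=
  if (n < 2 * q)%N then rotation (w ^+ n) else inversion \o rotation (w ^+ n).

Let wn n : (w ^+ n) ^+ (2 * q) = 1.
Proof. by rewrite exprAC omega_expr// expr1n. Qed.

Lemma rotation_generated n :
  generated [set (rotation w : M -> M); inversion] (rotation (w ^+ n)).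
Proof.
elim: n => [|n IH].
  have -> : rotation (w ^+ 0) = id by apply/funext => p; rewrite rotation1.
  exact: generated_id.
have -> : rotation (w ^+ n.+1) = rotation w \o rotation (w ^+ n).
  by apply/funext => p; rewrite /= rotationM// ?exprS// omega_expr.
by apply: generated_comp => //; apply: generated_mem; left.
Qed.

Lemma dihedral_elt_generated n :
  generated [set (rotation w : M -> M); inversion] (dihedral_elt n).
Proof.
rewrite /dihedral_elt; case: ifP => _; first exact: rotation_generated.
apply: generated_comp; last exact: rotation_generated.
by apply: generated_mem; right.
Qed.

Lemma rotation_inj i j : rotation (w ^+ i) = rotation (w ^+ j) ->
  w ^+ i = w ^+ j.
Proof.
have [p [_ y0]] := generic_point.
move=> /(congr1 (fun h => ycoord (h p))); rewrite !ycoord_rotation//.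
exact: mulIf.
Qed.

Lemma rotation_neq_inversion i j :
  rotation (w ^+ i) <> inversion \o rotation (w ^+ j).
Proof.
have w1 : `|w| = 1.
  by apply/eqP; rewrite -(@pexpr_eq1 _ _ (2 * q))// -normrX omega_expr// normr1.
have [p [x1 _]] := generic_point.
move=> /(congr1 (fun h => `|xcoord (h p)|)) /=.
rewrite xcoord_inversion !xcoord_rotation// normfV !normrM !normrX !w1.
rewrite !expr1n !mul1r => e.
have x0 : 0 < `|xcoord p| by exact: lt_trans x1.
by have := invf_lt1 x0; rewrite x1 -e lt_gtF.
Qed.

Lemma dihedral_elt_inj i j : (i < 4 * q)%N -> (j < 4 * q)%N ->
  dihedral_elt i = dihedral_elt j -> i = j.
Proof.
move=> i4 j4; rewrite /dihedral_elt; case: ltnP => iq; case: ltnP => jq.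
- by move/rotation_inj/omega_inj; apply.
- by move/rotation_neq_inversion.
- by move/esym/rotation_neq_inversion.
(* Both maps have the form s r^n; applying the involution s reduces the claim to rotations. *)
- move=> e; have : rotation (w ^+ i) = rotation (w ^+ j).
    apply/funext => p; have := congr1 (fun h => inversion (h p)) e.
    by rewrite /= !inversionK.
  (* Exponents in [2q, 4q) are shifted by 2q into the range where the powers of [w] are distinct. *)
  have wsub n : (2 * q <= n)%N -> w ^+ n = w ^+ (n - 2 * q).
    by move=> qn; rewrite -{1}(subnKC qn) exprD omega_expr// mul1r.
  move/rotation_inj; rewrite (wsub i)// (wsub j)//.
  by move/omega_inj; lia.
Qed.

(** An automorphism [h] not generated by r and s, together with the 4q distinct maps
    [dihedral_elt n], would give 4q + 1 automorphisms. *)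
Lemma Aut_generated : holomorphic (@id M) -> (@Aut R M #= `I_(4 * q))%card ->
  @Aut R M = generated [set (rotation w : M -> M); inversion].
Proof.
move=> hid card.
have sub : generated [set (rotation w : M -> M); inversion] `<=` @Aut R M.
  apply: generated_sub_Aut => //; first exact: charted_model.
  move=> _ [->|->]; last exact: inversion_Aut.
  by apply: rotation_Aut => //; exact: omega_expr.
apply/seteqP; split => // h hA; apply: contrapT => hG.
pose F n := if n == (4 * q)%N then h else dihedral_elt n.
have Finj : {in `I_(4 * q).+1 &, injective F}.
  move=> i j; rewrite !inE /= !ltnS /F => i4 j4.
  case: eqVneq => [->|iq]; case: eqVneq => [->//|jq].
  - by move=> e; case: hG; rewrite e; exact: dihedral_elt_generated.
  - by move=> e; case: hG; rewrite -e; exact: dihedral_elt_generated.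
  - by apply: dihedral_elt_inj; rewrite ltn_neqAle ?iq ?jq.
have FA : F @` `I_(4 * q).+1 `<=` @Aut R M.
  move=> _ [n _ <-]; rewrite /F; case: eqP => _ //.
  by apply: sub; exact: dihedral_elt_generated.
have cF : (F @` `I_(4 * q).+1 #= `I_(4 * q).+1)%card by exact: inj_card_eq Finj.
have := subset_card_le FA.
by rewrite (card_le_eql cF) (card_le_eqr card) card_le_II ltnn.
Qed.

End Counting.

(** * Transport from S_lambda to the model *)

Theorem theorem2 (R : realType) (q : nat) (gam lam : CC R) (S : surface R)
    (q_prime : prime q) (q_ge5 : (5 <= q)%N)
    (gam3 : gam ^+ 3 = -1) (gam_neq : gam != -1) (lam_Omega : Omega gam lam)
    (S_lam : is_S_lambda q lam S) (S_model : isomorphic S (model q lam)) :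
  exists r s : model q lam -> model q lam,
    [/\ forall P : affine_curve (model_poly q lam),
          exists2 P' : affine_curve (model_poly q lam), r (Some P) = Some P' &
            set_val P' = (omega R q * (set_val P).1,
                          omega R (2 * q) * (set_val P).2),
        forall P : affine_curve (model_poly q lam), (set_val P).1 != 0 ->
          exists2 P' : affine_curve (model_poly q lam), s (Some P) = Some P' &
            set_val P' = (1 / (set_val P).1,
                          (set_val P).2 / (set_val P).1 ^+ q.+1),
        Aut r,
        Aut s &
        @Aut R (model q lam) = generated [set r; s]].
Proof.
pose k : CC R := 2 * ((1 + lam) / (1 - lam)).
have q0 : (0 < q)%N by exact: leq_trans q_ge5.
have qq0 : (0 < 2 * q)%N by rewrite muln_gt0.
have [lam0 lam1] : lam != 0 /\ 1 - lam != 0.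
  move: lam_Omega; rewrite /Omega /= !inE !negb_or subr_eq0 [1 == _]eq_sym.
  by case/andP => -> /andP[-> _].
have k2 : k ^+ 2 != 4%:R.
  (* k^2 - 4 is the discriminant of T^2 + k T + 1; in this form it is nonzero because lambda is. *)
  rewrite -subr_eq0 (_ : _ - _ = 16%:R * lam / (1 - lam) ^+ 2).
    by rewrite !mulf_neq0 ?invr_eq0 ?expf_neq0 ?pnatr_eq0.
  by rewrite /k; field.
have [[[_ _ _ _ [cov charts _]] _ cardS] _] := S_lam.
have cS : charted S by [].
have cM : charted (model q lam) := charted_model q0 k2.
have hid : holomorphic (@id (model q lam)) := isomorphic_id cS cM S_model.
have cardM := isomorphic_Aut cS cM S_model cardS.
have wq : omega R (2 * q) ^+ (2 * q) = 1 by exact: omega_expr.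
exists (@rotation R q k (omega R (2 * q))), (@inversion R q k); split.
- move=> P; have [P' e P'E] := curve_pointP (rotation_curve (k := k) P wq).
  by exists P' => //; rewrite P'E omega_double.
- move=> P x0; have [P' e P'E] := curve_pointP (inversion_curve (k := k) x0).
  by exists P' => //; rewrite /inversion (negPf x0).
- exact: rotation_Aut.
- exact: inversion_Aut.
- exact: Aut_generated.
Qed.
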